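(* Let $H$ be a weak Hopf algebra, $(C,\leftharpoonup)$ a right partial $H$-module coalgebra and $(D,\blacktriangleleft)$ a right $H$-module coalgebra. Let $\theta:C\to D$ be a coalgebra monomorphism such that $D=\theta(C)\blacktriangleleft H$, and let $\pi:D\to D$ be a linear projection onto $\theta(C)$ satisfying $(\pi\otimes\pi)\Delta(d\blacktriangleleft h)=\Delta(\pi(d\blacktriangleleft h))$ for all $d\in D$, $h\in H$. Regard $C^*$ as a left partial $H$-module algebra via $(h\rightharpoondown\alpha)(c)=\alpha(c\leftharpoonup h)$ and $D^*$ as a left $H$-module algebra via $(h\triangleright\beta)(d)=\beta(d\blacktriangleleft h)$, and let $\varphi:C^*\to D^*$ be the multiplicative monomorphism $\varphi(\alpha)=\alpha\circ\theta^{-1}\circ\pi$, where $\theta^{-1}:\theta(C)\to C$ is the inverse of $\theta$ onto its image. Then $(\theta(C)\blacktriangleleft H,\theta,\pi)$ is a globalization for $C$ if and only if $(H\triangleright\varphi(C^* ),\varphi)$ is a globalization for $C^*$, where $H\triangleright\varphi(C^* )$ carries the product of $D^*$ and the action $\triangleright$.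
   Context: Everything is over a fixed field $\Bbbk$; Sweedler notation $\Delta(x)=x_1\otimes x_2$ is used. Duals $C^*,D^*$ are algebras under convolution $(\alpha\beta)(c)=\alpha(c_1)\beta(c_2)$ with unit $\varepsilon$. $\theta(C)\blacktriangleleft H$ and $H\triangleright\varphi(C^* )$ denote the linear spans of the elements $\theta(c)\blacktriangleleft h$, respectively $h\triangleright\varphi(\alpha)$. Weak Hopf algebra: a vector space $H$ that is an algebra and a coalgebra with $\Delta(hk)=\Delta(h)\Delta(k)$; $\varepsilon(hk\ell)=\varepsilon(hk_1)\varepsilon(k_2\ell)=\varepsilon(hk_2)\varepsilon(k_1\ell)$; $(1_H\otimes\Delta(1_H))(\Delta(1_H)\otimes1_H)=(\Delta(1_H)\otimes1_H)(1_H\otimes\Delta(1_H))=\Delta^2(1_H)$; together with a linear antipode $S:H\to H$ with $h_1S(h_2)=\varepsilon_t(h)$, $S(h_1)h_2=\varepsilon_s(h)$, $S(h_1)h_2S(h_3)=S(h)$, where $\varepsilon_t(h)=\varepsilon(1_1h)1_2$, $\varepsilon_s(h)=1_1\varepsilon(h1_2)$ and $1_1\otimes1_2=\Delta(1_H)$. Right partial $H$-module coalgebra: a coalgebra $C$ with a linear map $\leftharpoonup:C\otimes H\to C$ such that $c\leftharpoonup1_H=c$; $\Delta(c\leftharpoonup h)=c_1\leftharpoonup h_1\otimes c_2\leftharpoonup h_2$; $(c\leftharpoonup h)\leftharpoonup k=\varepsilon(c_1\leftharpoonup h_1)\,(c_2\leftharpoonup h_2k)$. Right $H$-module coalgebra: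 a coalgebra $D$ with a linear map $\blacktriangleleft:D\otimes H\to D$ such that $d\blacktriangleleft1_H=d$; $\Delta(d\blacktriangleleft h)=d_1\blacktriangleleft h_1\otimes d_2\blacktriangleleft h_2$; $(d\blacktriangleleft h)\blacktriangleleft k=d\blacktriangleleft hk$ (over a weak Hopf algebra the further axiom $\varepsilon(d\blacktriangleleft h)=\varepsilon(d\blacktriangleleft\varepsilon_t(h))$ is automatic). Left partial $H$-module algebra: a (unital) algebra $A$ with a linear map $\cdot:H\otimes A\to A$ such that $1_H\cdot a=a$; $h\cdot ab=(h_1\cdot a)(h_2\cdot b)$; $h\cdot(k\cdot a)=(h_1\cdot1_A)(h_2k\cdot a)$. Left $H$-module algebra: an associative algebra $B$ (not required to be unital) with a linear map $\triangleright:H\otimes B\to B$ such that $1_H\triangleright a=a$; $h\triangleright ab=(h_1\triangleright a)(h_2\triangleright b)$; $h\triangleright(k\triangleright a)=hk\triangleright a$ (when $B$ is unital and $H$ is a weak Hopf algebra, $h\triangleright1_B=\varepsilon_t(h)\triangleright1_B$ is automatic). Globalization of a right partial $H$-module coalgebra $(C,\leftharpoonup)$: a triple $(D,\theta,\pi)$ such that (i) $D$ is a right $H$-module coalgebra via $\blacktriangleleft$; (ii) $\theta:C\to D$ is a coalgebra monomorphism; (iii) $\pi:D\to D$ is a linear projection onto $\theta(C)$ such that for all $c\in C$, $d\in D$, $h\in H$: $(\pi\otimes\pi)\Delta(d\blacktriangleleft h)=\Delta(\pi(d\blacktriangleleft h))$, $\pi(\pi(d)\blacktriangleleft h)=\varepsilon(\pi(d_1))\pi(d_2\blacktriangleleft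 h)$, and $\theta(c\leftharpoonup h)=\pi(\theta(c)\blacktriangleleft h)$; (iv) $D=\theta(C)\blacktriangleleft H$. Globalization of a left partial $H$-module algebra $(A,\cdot)$: a pair $(B,\vartheta)$ where $B$ is a left $H$-module algebra via $\triangleright$ and (i) $\vartheta:A\to B$ is an algebra (multiplicative, linear) monomorphism with $\vartheta(A)$ a right ideal of $B$; (ii) $\vartheta(h\cdot a)=\vartheta(1_A)(h\triangleright\vartheta(a))$ for all $h\in H$, $a\in A$; (iii) $B=H\triangleright\vartheta(A)$. *)

(* Defs.v *)
From HB Require Import structures.
From mathcomp Require Import all_boot all_order all_algebra.
From mathcomp Require Import sesquilinear.
From mathcomp Require Import boolp classical_sets.

Set Implicit Arguments.
Unset Strict Implicit.
Unset Printing Implicit Defensive.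

Import GRing.Theory.
Local Open Scope ring_scope.
Local Open Scope quotient_scope.

Reserved Notation "U \otimes V" (at level 40, left associativity).
Reserved Notation "u \ox v" (at level 40, left associativity).
Reserved Notation "x ** y" (at level 40, left associativity).
Reserved Notation "\1" (at level 0).
Reserved Notation "\sw_ ( x , y <- t ) E"
  (at level 41, E at level 41, x name, y name, t at level 50,
   format "'[' \sw_ ( x ,  y  <-  t ) '/  '  E ']'").

(** [s : seq (U * V)] stands for the formal sum of the pure tensors
    [p.1 (x) p.2], [p] in [s]; two formal sums are identified when every
    bilinear map takes the same value on them. The lemmas [tens_bilinear],
    [tensorE] and [tlift_tens], [tlift_linear] below (bilinearity of the pure
    tensors, which span, and factorization of every bilinear map) characterize
    the resulting space as the tensor product. *)

Section TensorDef.
Variables (k : fieldType) (U V : lmodType k).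

Definition tens_rel : rel (seq (U * V)) := fun s t =>
  `[< forall (W : lmodType k) (f : {bilinear U -> V -> W}),
        \sum_(p <- s) f p.1 p.2 = \sum_(p <- t) f p.1 p.2 >].

Lemma tens_rel_refl : reflexive tens_rel.
Proof. by move=> s; apply/asboolP. Qed.

Lemma tens_rel_sym : symmetric tens_rel.
Proof.
by move=> s t; apply/asboolP/asboolP => st W f; rewrite st.
Qed.

Lemma tens_rel_trans : transitive tens_rel.
Proof.
move=> t s u /asboolP st /asboolP tu; apply/asboolP => W f.
by rewrite st tu.
Qed.

Canonical tens_equiv :=
  EquivRel tens_rel tens_rel_refl tens_rel_sym tens_rel_trans.

Definition tensor := {eq_quot tens_equiv}.

HB.instance Definition _ := Choice.on tensor.
HB.instance Definition _ := Quotient.on tensor.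
HB.instance Definition _ := EqQuotient.on tensor.

Definition tens (u : U) (v : V) : tensor := \pi_tensor [:: (u, v)].

Lemma tensP (s t : seq (U * V)) :
  (forall (W : lmodType k) (f : {bilinear U -> V -> W}),
     \sum_(p <- s) f p.1 p.2 = \sum_(p <- t) f p.1 p.2) ->
  \pi_tensor s = \pi_tensor t.
Proof. by move=> st; apply/eqmodP/asboolP. Qed.

Lemma repr_tens (s : seq (U * V)) (W : lmodType k)
    (f : {bilinear U -> V -> W}) :
  \sum_(p <- repr (\pi_tensor s)) f p.1 p.2 = \sum_(p <- s) f p.1 p.2.
Proof.
have /eqmodP/asboolP : repr (\pi_tensor s) = s %[mod tensor] by rewrite reprK.
exact.
Qed.

Definition tens0 : tensor := \pi_tensor [::].
Definition tens_add (s t : tensor) : tensor := \pi_tensor (repr s ++ repr t).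
Definition tens_scale (a : k) (s : tensor) : tensor :=
  \pi_tensor [seq (a *: p.1, p.2) | p <- repr s].
Definition tens_opp (s : tensor) : tensor := tens_scale (-1) s.

Lemma tens_eq (s t : tensor) :
  (forall (W : lmodType k) (f : {bilinear U -> V -> W}),
     \sum_(p <- repr s) f p.1 p.2 = \sum_(p <- repr t) f p.1 p.2) -> s = t.
Proof. by move=> st; rewrite -[s]reprK -[t]reprK; apply: tensP. Qed.

Let val_add s t (W : lmodType k) (f : {bilinear U -> V -> W}) :
  \sum_(p <- repr (tens_add s t)) f p.1 p.2 =
  \sum_(p <- repr s) f p.1 p.2 + \sum_(p <- repr t) f p.1 p.2.
Proof. by rewrite repr_tens big_cat. Qed.

Let val_scale a s (W : lmodType k) (f : {bilinear U -> V -> W}) :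
  \sum_(p <- repr (tens_scale a s)) f p.1 p.2 =
  a *: \sum_(p <- repr s) f p.1 p.2.
Proof.
rewrite repr_tens big_map scaler_sumr; apply: eq_bigr => p _.
by rewrite /= linearZl_LR.
Qed.

Let val_0 (W : lmodType k) (f : {bilinear U -> V -> W}) :
  \sum_(p <- repr tens0) f p.1 p.2 = 0.
Proof. by rewrite repr_tens big_nil. Qed.

Fact tens_addA : associative tens_add.
Proof. by move=> s t u; apply: tens_eq => W f; rewrite !val_add addrA. Qed.
Fact tens_addC : commutative tens_add.
Proof. by move=> s t; apply: tens_eq => W f; rewrite !val_add addrC. Qed.
Fact tens_add0 : left_id tens0 tens_add.
Proof. by move=> s; apply: tens_eq => W f; rewrite val_add val_0 add0r. Qed.
Fact tens_addN : left_inverse tens0 tens_opp tens_add.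
Proof.
move=> s; apply: tens_eq => W f.
by rewrite val_add val_scale val_0 scaleN1r addNr.
Qed.

HB.instance Definition _ :=
  GRing.isZmodule.Build tensor tens_addA tens_addC tens_add0 tens_addN.

Fact tens_scaleA a b s : tens_scale a (tens_scale b s) = tens_scale (a * b) s.
Proof. by apply: tens_eq => W f; rewrite !val_scale scalerA. Qed.
Fact tens_scale1 : left_id 1 tens_scale.
Proof. by move=> s; apply: tens_eq => W f; rewrite val_scale scale1r. Qed.
Fact tens_scaleDr : right_distributive tens_scale +%R.
Proof.
move=> a s t; apply: tens_eq => W f.
by rewrite val_scale !val_add !val_scale scalerDr.
Qed.
Fact tens_scaleDl s : {morph tens_scale^~ s : a b / a + b}.
Proof.
move=> a b; apply: tens_eq => W f.
by rewrite val_scale val_add !val_scale scalerDl.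
Qed.

HB.instance Definition _ := GRing.Zmodule_isLmodule.Build k tensor
  tens_scaleA tens_scale1 tens_scaleDr tens_scaleDl.

Fact tens_bilinear :
  bilinear_for (GRing.Scale.Law.clone _ _ *:%R _)
               (GRing.Scale.Law.clone _ _ *:%R _) tens.
Proof.
split=> [v a u u'|u a v v'] /=; apply: tens_eq => W f;
  rewrite val_add val_scale !repr_tens !big_seq1 /=;
  by rewrite ?linearPl ?linearPr.
Qed.

HB.instance Definition _ :=
  bilinear_isBilinear.Build k U V tensor *:%R *:%R tens tens_bilinear.

(** For a bilinear [f], [tlift f] is the linear map with
    [tlift f (tens u v) = f u v]. The definition evaluates [f] on a chosen
    representative, and is used for bilinear [f] only. *)
Definition tlift (W : zmodType) (f : U -> V -> W) (t : tensor) : W :=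
  \sum_(p <- repr t) f p.1 p.2.

Section Lift.
Variables (W : lmodType k) (f : U -> V -> W).
Hypothesis f_bil : bilinear_for (GRing.Scale.Law.clone _ _ *:%R _)
                                (GRing.Scale.Law.clone _ _ *:%R _) f.

Let F : {bilinear U -> V -> W} :=
  HB.pack f (@bilinear_isBilinear.Build k U V W *:%R *:%R f f_bil).

Lemma tlift_tens u v : tlift f (tens u v) = f u v.
Proof. by rewrite /tlift (repr_tens _ F) big_seq1. Qed.

Lemma tlift_linear : linear (tlift f).
Proof.
by move=> a s t; rewrite /tlift (val_add _ _ F) (val_scale _ _ F).
Qed.
End Lift.

End TensorDef.

Notation "U \otimes V" := (tensor U V) : type_scope.
Notation "u \ox v" := (tens u v) : ring_scope.
(** Sweedler notation: [\sw_(x, y <- t) E x y] is the value of the linear map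
    extending [x (x) y |-> E x y] at the tensor [t]. *)
Notation "\sw_ ( x , y <- t ) E" := (tlift (fun x y => E) t) : ring_scope.

Section TensorTheory.
Variables (k : fieldType) (U V : lmodType k).

Lemma tensorE (t : U \otimes V) : t = \sw_(u, v <- t) (u \ox v).
Proof.
apply: tens_eq => W f.
pose G := tlift f.
have fbil : bilinear_for (GRing.Scale.Law.clone _ _ *:%R _)
                         (GRing.Scale.Law.clone _ _ *:%R _) f.
  by split=> [v a u u'|u a v v']; rewrite ?linearPl ?linearPr.
pose L : {linear U \otimes V -> W} :=
  HB.pack G (GRing.isLinear.Build k _ _ _ G (tlift_linear fbil)).
rewrite -[RHS]/(L (\sum_(p <- repr t) p.1 \ox p.2)) raddf_sum.
by apply: eq_bigr => p _; rewrite -[RHS]/(tlift f _) tlift_tens.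
Qed.

Lemma eq_tlift (W : zmodType) (f g : U -> V -> W) (t : U \otimes V) :
  (forall x y, f x y = g x y) -> tlift f t = tlift g t.
Proof. by move=> fg; apply: eq_bigr => p _. Qed.

Lemma raddf_tlift (W W' : zmodType) (g : {additive W -> W'})
    (f : U -> V -> W) (t : U \otimes V) :
  g (tlift f t) = \sw_(x, y <- t) g (f x y).
Proof. exact: raddf_sum. Qed.

Lemma exchange_tlift (U' V' : lmodType k) (W : zmodType)
    (f : U -> V -> U' -> V' -> W) (s : U \otimes V) (t : U' \otimes V') :
  \sw_(x, y <- s) \sw_(x', y' <- t) f x y x' y' =
  \sw_(x', y' <- t) \sw_(x, y <- s) f x y x' y'.
Proof. exact: exchange_big. Qed.

End TensorTheory.

(** [tmul m n] is the product [(a (x) b)(c (x) d) = m a c (x) n b d] on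
    [U (x) V]. *)
Definition tmul (k : fieldType) (U V : lmodType k)
    (m : U -> U -> U) (n : V -> V -> V) (s t : U \otimes V) : U \otimes V :=
  \sw_(a, b <- s) \sw_(c, d <- t) (m a c \ox n b d).

Definition tmap (k : fieldType) (U V U' V' : lmodType k)
    (f : U -> U') (g : V -> V') (t : U \otimes V) : U' \otimes V' :=
  \sw_(x, y <- t) (f x \ox g y).

(** A unital associative [k]-algebra. MathComp's [algType] cannot be used, as it
    requires [1 != 0]: the zero algebra is the dual of the zero coalgebra. *)
HB.mixin Record isUAlgebra (k : fieldType) A of GRing.Lmodule k A := {
  amul : {bilinear A -> A -> A};
  aone : A;
  amulA : forall x y z, amul x (amul y z) = amul (amul x y) z;
  amul1a : forall x, amul aone x = x;
  amula1 : forall x, amul x aone = x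
}.
#[short(type="ualgType")]
HB.structure Definition UAlgebra (k : fieldType) :=
  {A of GRing.Lmodule k A & isUAlgebra k A}.

Notation "x ** y" := (amul x y) : ring_scope.
Notation "\1" := aone : ring_scope.

HB.mixin Record isCoalgebra (k : fieldType) C of GRing.Lmodule k C := {
  comul : {linear C -> C \otimes C};
  counit : {scalar C};
  comulA : forall c,
    \sw_(x, y <- comul c) (comul x \ox y) =
    \sw_(x, y <- comul c) \sw_(y1, y2 <- comul y) (x \ox y1 \ox y2);
  counitl : forall c, \sw_(x, y <- comul c) (counit x *: y) = c;
  counitr : forall c, \sw_(x, y <- comul c) (counit y *: x) = c
}.
#[short(type="coalgType")]
HB.structure Definition Coalgebra (k : fieldType) :=
  {C of GRing.Lmodule k C & isCoalgebra k C}.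

#[short(type="algCoalgType")]
HB.structure Definition AlgCoalg (k : fieldType) :=
  {H of UAlgebra k H & Coalgebra k H}.

Section EpsDef.
Variables (k : fieldType) (H : algCoalgType k).

Definition eps_t (h : H) : H :=
  \sw_(x, y <- comul (\1 : H)) (counit (x ** h) *: y).
Definition eps_s (h : H) : H :=
  \sw_(x, y <- comul (\1 : H)) (counit (h ** y) *: x).

Definition tmul2 : H \otimes H -> H \otimes H -> H \otimes H :=
  tmul (@amul k H) (@amul k H).
Definition tmul3 : H \otimes H \otimes H -> H \otimes H \otimes H ->
    H \otimes H \otimes H :=
  tmul tmul2 (@amul k H).

(** [1 (x) Delta(1)], [Delta(1) (x) 1] and [Delta^2(1)] in [H (x) H (x) H]. *)
Definition one_comul1 : H \otimes H \otimes H :=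
  \sw_(x, y <- comul (\1 : H)) (\1 \ox x \ox y).
Definition comul1_one : H \otimes H \otimes H := comul (\1 : H) \ox \1.
Definition comul2_1 : H \otimes H \otimes H :=
  \sw_(x, y <- comul (\1 : H)) (comul x \ox y).
End EpsDef.

HB.mixin Record isWeakHopf (k : fieldType) H of AlgCoalg k H := {
  antipode : {linear H -> H};
  comulM : forall h l : H, comul (h ** l) = tmul2 (comul h) (comul l);
  counitM12 : forall h l m : H, counit (h ** l ** m) =
    \sw_(l1, l2 <- comul l) (counit (h ** l1) * counit (l2 ** m));
  counitM21 : forall h l m : H, counit (h ** l ** m) =
    \sw_(l1, l2 <- comul l) (counit (h ** l2) * counit (l1 ** m));
  comul1_rl : tmul3 (one_comul1 H) (comul1_one H) = comul2_1 H;
  comul1_lr : tmul3 (comul1_one H) (one_comul1 H) = comul2_1 H;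
  antipode_t : forall h : H,
    \sw_(h1, h2 <- comul h) (h1 ** antipode h2) = eps_t h;
  antipode_s : forall h : H,
    \sw_(h1, h2 <- comul h) (antipode h1 ** h2) = eps_s h;
  antipode_ss : forall h : H,
    \sw_(h12, h3 <- comul h) \sw_(h1, h2 <- comul h12)
      (antipode h1 ** h2 ** antipode h3) = antipode h
}.
#[short(type="weakHopfType")]
HB.structure Definition WeakHopf (k : fieldType) :=
  {H of AlgCoalg k H & isWeakHopf k H}.

Section DualSpace.
Variables (k : fieldType) (C : lmodType k).

Definition dual := {scalar C}.

HB.instance Definition _ := gen_eqMixin dual.
HB.instance Definition _ := gen_choiceMixin dual.

Lemma dualP (f g : dual) : (forall c, f c = g c) -> f = g.
Proof.
case: f g => [f fP] [g gP] /= /funext fg; case: _ / fg in gP *.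
case: fP gP => [[fD] [fZ]] [[gD] [gZ]].
by rewrite (Prop_irrelevance fD gD) (Prop_irrelevance fZ gZ).
Qed.

Definition mk_dual (f : C -> k) (fP : scalar f) : dual :=
  HB.pack f (GRing.isLinear.Build k C k *%R f fP).

Fact dual0_subproof : scalar (fun _ : C => 0 : k).
Proof. by move=> a x y /=; rewrite mulr0 addr0. Qed.
Fact dualN_subproof (f : dual) : scalar (fun c => - f c).
Proof. by move=> a x y /=; rewrite linearP opprD mulrN. Qed.
Fact dualD_subproof (f g : dual) : scalar (fun c => f c + g c).
Proof. by move=> a x y /=; rewrite !linearP addrACA mulrDr. Qed.
Fact dualZ_subproof (b : k) (f : dual) : scalar (fun c => b * f c).
Proof. by move=> a x y /=; rewrite linearP mulrDr mulrCA. Qed.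

Definition dual0 := mk_dual dual0_subproof.
Definition dualN f := mk_dual (dualN_subproof f).
Definition dualD f g := mk_dual (dualD_subproof f g).
Definition dualZ b f := mk_dual (dualZ_subproof b f).

Fact dualDA : associative dualD.
Proof. by move=> f g h; apply: dualP => c /=; rewrite addrA. Qed.
Fact dualDC : commutative dualD.
Proof. by move=> f g; apply: dualP => c /=; rewrite addrC. Qed.
Fact dual0D : left_id dual0 dualD.
Proof. by move=> f; apply: dualP => c /=; rewrite add0r. Qed.
Fact dualND : left_inverse dual0 dualN dualD.
Proof. by move=> f; apply: dualP => c /=; rewrite addNr. Qed.
HB.instance Definition _ :=
  GRing.isZmodule.Build dual dualDA dualDC dual0D dualND.

Fact dualZA a b f : dualZ a (dualZ b f) = dualZ (a * b) f.
Proof. by apply: dualP => c /=; rewrite mulrA. Qed.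
Fact dual1Z : left_id 1 dualZ.
Proof. by move=> f; apply: dualP => c /=; rewrite mul1r. Qed.
Fact dualZDr : right_distributive dualZ +%R.
Proof. by move=> a f g; apply: dualP => c /=; rewrite mulrDr. Qed.
Fact dualZDl f : {morph dualZ^~ f : a b / a + b}.
Proof. by move=> a b; apply: dualP => c /=; rewrite mulrDl. Qed.
HB.instance Definition _ := GRing.Zmodule_isLmodule.Build k dual
  dualZA dual1Z dualZDr dualZDl.

Lemma dualDE (f g : dual) c : (f + g) c = f c + g c. Proof. by []. Qed.
Lemma dualZE (a : k) (f : dual) c : (a *: f) c = a * f c. Proof. by []. Qed.

Definition deval (c : C) (f : dual) : k := f c.
Fact deval_scalar c : scalar (deval c).
Proof. by []. Qed.
HB.instance Definition _ c :=
  GRing.isLinear.Build k dual k *%R (deval c) (deval_scalar c).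

End DualSpace.

Section TliftScalar.
Variables (k : fieldType) (U V : lmodType k) (f : U -> V -> k).
Hypothesis fl : forall v, scalar (f ^~ v).
Hypothesis fr : forall u, scalar (f u).

Lemma tlift_tens_k u v : tlift f (u \ox v) = f u v.
Proof. exact: (@tlift_tens _ _ _ k^o f (fl, fr)). Qed.

Lemma tlift_scalar : scalar (tlift f).
Proof. exact: (@tlift_linear _ _ _ k^o f (fl, fr)). Qed.
End TliftScalar.

Section DualAlgebra.
Variables (k : fieldType) (C : coalgType k).
Implicit Types f g h : dual C.

Let prod_l f g v : scalar ((fun x y => f x * g y) ^~ v).
Proof. by move=> a x y; rewrite linearP mulrDl mulrA. Qed.
Let prod_r f g u : scalar ((fun x y => f x * g y) u).
Proof. by move=> a x y; rewrite linearP mulrDr mulrCA. Qed.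

Let conv_scalar f g : scalar (fun c => \sw_(x, y <- comul c) (f x * g y)).
Proof.
move=> a x y; rewrite linearP.
exact: (tlift_scalar (prod_l f g) (prod_r f g)).
Qed.

Definition conv f g : dual C := mk_dual (conv_scalar f g).

Fact convA : associative conv.
Proof.
move=> f g h; apply: dualP => c /=.
pose F u := \sw_(x, y <- u) (f x * g y).
have FL : scalar F := tlift_scalar (prod_l f g) (prod_r f g).
pose G := tlift (fun (u : C \otimes C) (z : C) => F u * h z).
have Gl v : scalar ((fun (u : C \otimes C) (z : C) => F u * h z) ^~ v).
  by move=> a x y; rewrite FL mulrDl mulrA.
have Gr u : scalar ((fun (u : C \otimes C) (z : C) => F u * h z) u).
  by move=> a x y; rewrite linearP mulrDr mulrCA.
have GL : scalar G := tlift_scalar Gl Gr.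
pose L : {scalar C \otimes C \otimes C} :=
  HB.pack G (GRing.isLinear.Build k _ _ _ G GL).
have GT (U V : lmodType k) (e : U -> V -> C \otimes C \otimes C) t :
  G (tlift e t) = \sw_(x, y <- t) G (e x y) := raddf_tlift L e t.
have GE u z : G (u \ox z) = F u * h z := tlift_tens_k Gl Gr u z.
have := congr1 G (comulA c); rewrite !GT => e.
transitivity (\sw_(x, y <- comul c) G (comul x \ox y)); last first.
  by apply: eq_tlift => x y; rewrite GE.
rewrite e; apply: eq_tlift => x y; rewrite GT /tlift mulr_sumr.
apply: eq_bigr => p _.
by rewrite GE /F (tlift_tens_k (prod_l f g) (prod_r f g)) -mulrA.
Qed.

Fact conv1f : left_id (counit : dual C) conv.
Proof.
move=> f; apply: dualP => c /=; rewrite -[in RHS](counitl c) raddf_tlift.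
by apply: eq_tlift => x y; exact: esym (scalarZ f _ _).
Qed.
Fact convf1 : right_id (counit : dual C) conv.
Proof.
move=> f; apply: dualP => c /=; rewrite -[in RHS](counitr c) raddf_tlift.
by apply: eq_tlift => x y; rewrite mulrC; exact: esym (scalarZ f _ _).
Qed.
Fact conv_bilinear :
  bilinear_for (GRing.Scale.Law.clone _ _ *:%R _)
               (GRing.Scale.Law.clone _ _ *:%R _) conv.
Proof.
split=> [h a f g|h a f g] /=; apply: dualP => c;
  rewrite dualDE dualZE /= /tlift mulr_sumr -big_split;
  apply: eq_bigr => p _.
  by rewrite mulrDl mulrA.
by rewrite mulrDr mulrCA.
Qed.
HB.instance Definition _ :=
  bilinear_isBilinear.Build k (dual C) (dual C) (dual C) *:%R *:%R conv
    conv_bilinear.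

HB.instance Definition _ := isUAlgebra.Build k (dual C)
  convA conv1f convf1.

Lemma dualM f g c : (f ** g) c = \sw_(x, y <- comul c) (f x * g y).
Proof. by []. Qed.
Lemma dual1 c : (\1 : dual C) c = counit c.
Proof. by []. Qed.

Lemma conv_tens f g x y :
  \sw_(x, y <- x \ox y) (f x * g y) = f x * g y.
Proof. exact: (tlift_tens_k (prod_l f g) (prod_r f g)). Qed.

Lemma conv_scalar2 f g :
  scalar (fun t : C \otimes C => \sw_(x, y <- t) (f x * g y)).
Proof. exact: (tlift_scalar (prod_l f g) (prod_r f g)). Qed.

End DualAlgebra.

Section Actions.
Variables (k : fieldType) (H : weakHopfType k).

Record partial_module_coalgebra (C : coalgType k) := PartialModuleCoalgebra {
  pmc_act :> {bilinear C -> H -> C};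
  pmc_act1 : forall c, pmc_act c \1 = c;
  pmc_comul : forall c h, comul (pmc_act c h) =
    \sw_(c1, c2 <- comul c) \sw_(h1, h2 <- comul h)
      (pmc_act c1 h1 \ox pmc_act c2 h2);
  pmc_actM : forall c h l, pmc_act (pmc_act c h) l =
    \sw_(c1, c2 <- comul c) \sw_(h1, h2 <- comul h)
      (counit (pmc_act c1 h1) *: pmc_act c2 (h2 ** l))
}.

Record module_coalgebra (D : coalgType k) := ModuleCoalgebra {
  mc_act :> {bilinear D -> H -> D};
  mc_act1 : forall d, mc_act d \1 = d;
  mc_comul : forall d h, comul (mc_act d h) =
    \sw_(d1, d2 <- comul d) \sw_(h1, h2 <- comul h)
      (mc_act d1 h1 \ox mc_act d2 h2);
  mc_actM : forall d h l, mc_act (mc_act d h) l = mc_act d (h ** l)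
}.

Record partial_module_algebra (A : ualgType k) := PartialModuleAlgebra {
  pma_act :> {bilinear H -> A -> A};
  pma_act1 : forall a, pma_act \1 a = a;
  pma_mul : forall h a b, pma_act h (a ** b) =
    \sw_(h1, h2 <- comul h) (pma_act h1 a ** pma_act h2 b);
  pma_actM : forall h l a, pma_act h (pma_act l a) =
    \sw_(h1, h2 <- comul h) (pma_act h1 \1 ** pma_act (h2 ** l) a)
}.

(** The underlying associative algebra, not necessarily unital, is part of the
    structure. *)
Record module_algebra (B : lmodType k) := ModuleAlgebra {
  ma_mul : {bilinear B -> B -> B};
  ma_act :> {bilinear H -> B -> B};
  ma_mulA : forall x y z, ma_mul x (ma_mul y z) = ma_mul (ma_mul x y) z;
  ma_act1 : forall b, ma_act \1 b = b;
  ma_actmul : forall h a b, ma_act h (ma_mul a b) =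
    \sw_(h1, h2 <- comul h) (ma_mul (ma_act h1 a) (ma_act h2 b));
  ma_actM : forall h l b, ma_act h (ma_act l b) = ma_act (h ** l) b
}.

End Actions.

Section DualAct.
Variables (k : fieldType) (H : weakHopfType k) (C : coalgType k).

Section Def.
Variable act : {bilinear C -> H -> C}.

Fact dual_act_scalar (h : H) (f : dual C) : scalar (fun c => f (act c h)).
Proof. by move=> a x y; rewrite linearPl linearP. Qed.

Definition dual_act (h : H) (f : dual C) : dual C :=
  mk_dual (dual_act_scalar h f).

Fact dual_act_bilinear :
  bilinear_for (GRing.Scale.Law.clone _ _ *:%R _)
               (GRing.Scale.Law.clone _ _ *:%R _) dual_act.
Proof.
split=> [f a h l|h a f g] /=; apply: dualP => c //=.
by rewrite linearPr linearP.
Qed.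
HB.instance Definition _ :=
  bilinear_isBilinear.Build k H (dual C) (dual C) *:%R *:%R dual_act
    dual_act_bilinear.

Lemma dual_tlift (U V : lmodType k) (e : U -> V -> dual C) (t : U \otimes V) c :
  (tlift e t : dual C) c = \sw_(x, y <- t) e x y c.
Proof. exact: (raddf_tlift (@deval k C c)). Qed.

Lemma scalar_tlift (U V W : lmodType k) (g : W -> k) (e : U -> V -> W)
  (t : U \otimes V) : scalar g -> g (tlift e t) = \sw_(x, y <- t) g (e x y).
Proof.
move=> gP; exact: (raddf_tlift (HB.pack_for {scalar W} g
  (GRing.isLinear.Build k _ _ _ g gP)) e t).
Qed.

Hypothesis act_comul : forall c h, comul (act c h) =
    \sw_(c1, c2 <- comul c) \sw_(h1, h2 <- comul h)
      (act c1 h1 \ox act c2 h2).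

Lemma dual_act_conv h f g : dual_act h (f ** g) =
  \sw_(h1, h2 <- comul h) (dual_act h1 f ** dual_act h2 g).
Proof.
apply: dualP => c; rewrite dual_tlift /= act_comul.
rewrite (scalar_tlift _ _ (conv_scalar2 f g)) exchange_tlift.
apply: eq_tlift => c1 c2; rewrite (scalar_tlift _ _ (conv_scalar2 f g)).
by apply: eq_tlift => h1 h2; rewrite conv_tens.
Qed.
End Def.
End DualAct.

Section DualModules.
Variables (k : fieldType) (H : weakHopfType k) (C : coalgType k).

Section Partial.
Variable pC : partial_module_coalgebra H C.

Fact dual_pact1 (f : dual C) : dual_act pC \1 f = f.
Proof. by apply: dualP => c /=; rewrite pmc_act1. Qed.

Fact dual_pactM h l (f : dual C) : dual_act pC h (dual_act pC l f) =
  \sw_(h1, h2 <- comul h) (dual_act pC h1 \1 ** dual_act pC (h2 ** l) f).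
Proof.
apply: dualP => c; rewrite dual_tlift /= pmc_actM.
rewrite (scalar_tlift _ _ (scalarP f)) [RHS]exchange_tlift.
apply: eq_tlift => c1 c2; rewrite (scalar_tlift _ _ (scalarP f)).
by apply: eq_tlift => h1 h2; exact: (scalarZ f).
Qed.

Definition dual_partial_module_algebra : partial_module_algebra H (dual C) :=
  @PartialModuleAlgebra k H (dual C) (dual_act pC) dual_pact1
    (dual_act_conv (@pmc_comul _ _ _ pC)) dual_pactM.
End Partial.

Section Global.
Variable mC : module_coalgebra H C.

Fact dual_mact1 (f : dual C) : dual_act mC \1 f = f.
Proof. by apply: dualP => c /=; rewrite mc_act1. Qed.

Fact dual_mactM h l (f : dual C) :
  dual_act mC h (dual_act mC l f) = dual_act mC (h ** l) f.
Proof. by apply: dualP => c /=; rewrite mc_actM. Qed.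

Definition dual_module_algebra : module_algebra H (dual C) :=
  @ModuleAlgebra k H (dual C) (@amul k (dual C)) (dual_act mC)
    (@amulA k (dual C)) dual_mact1
    (dual_act_conv (@mc_comul _ _ _ mC)) dual_mactM.
End Global.
End DualModules.

Section Span.
Variables (k : fieldType) (V : lmodType k) (P : V -> Prop).

Definition in_span (v : V) : Prop :=
  exists2 s : seq (k * V), (forall p, p \in s -> P p.2) &
    v = \sum_(p <- s) p.1 *: p.2.

Lemma in_span_gen v : P v -> in_span v.
Proof.
move=> Pv; exists [:: (1, v)]; last by rewrite big_seq1 scale1r.
by move=> p; rewrite inE => /eqP->.
Qed.

Definition span_pred : {pred V} := fun v => `[< in_span v >].

Fact span_submod_closed : submod_closed span_pred.
Proof.
split=> [|a u v /asboolP[s sP ->] /asboolP[t tP ->]]; apply/asboolP.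
  by exists [::] => //; rewrite big_nil.
exists ([seq (a * p.1, p.2) | p <- s] ++ t).
  by move=> p; rewrite mem_cat => /orP[/mapP[q qs ->]|]; [exact: (sP q)|exact: tP].
rewrite big_cat big_map scaler_sumr; congr (_ + _).
by apply: eq_bigr => p _; rewrite scalerA.
Qed.
HB.instance Definition _ :=
  GRing.isSubmodClosed.Build k V span_pred span_submod_closed.

Record span := Span { span_val : V; _ : span_val \in span_pred }.
HB.instance Definition _ := [isSub for span_val].
HB.instance Definition _ := [Choice of span by <:].
HB.instance Definition _ := [SubChoice_isSubLmodule of span by <:].

Lemma span_valP (x : span) : in_span (\val x).
Proof. by apply/asboolP/(valP x). Qed.

Definition mk_span (v : V) (Pv : P v) : span :=
  @Span v (introT (asboolP _) (in_span_gen Pv)).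
End Span.

Record coalgebra_mono (k : fieldType) (C D : coalgType k) := CoalgebraMono {
  cm_map :> {linear C -> D};
  cm_inj : injective cm_map;
  cm_comul : forall c, comul (cm_map c) = tmap cm_map cm_map (comul c);
  cm_counit : forall c, counit (cm_map c) = counit c
}.

Record projection_onto (k : fieldType) (C D : lmodType k) (theta : C -> D) :=
  ProjectionOnto {
  pr_map :> {linear D -> D};
  pr_idem : forall d, pr_map (pr_map d) = pr_map d;
  pr_range : range pr_map = range theta
}.

Section CoalgebraGlobalization.
Variables (k : fieldType) (H : weakHopfType k) (C D : coalgType k).

(** The elements [theta(c) . h], whose span is [theta(C) . H]. *)
Definition image_act (mD : module_coalgebra H D) (theta : C -> D) (d : D) :
    Prop := exists c h, d = mD (theta c) h.

Definition proj_comul (mD : module_coalgebra H D) (pi : D -> D) : Prop :=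
  forall d h, tmap pi pi (comul (mD d h)) = comul (pi (mD d h)).

Record coalgebra_globalization (pC : partial_module_coalgebra H C)
    (mD : module_coalgebra H D) (theta : coalgebra_mono C D)
    (pi : projection_onto theta) : Prop := CoalgebraGlobalization {
  cg_comul : proj_comul mD pi;
  cg_act : forall d h, pi (mD (pi d) h) =
    \sw_(d1, d2 <- comul d) (counit (pi d1) *: pi (mD d2 h));
  cg_pact : forall c h, theta (pC c h) = pi (mD (theta c) h);
  cg_span : forall d, in_span (image_act mD theta) d
}.
End CoalgebraGlobalization.

Section AlgebraGlobalization.
Variables (k : fieldType) (H : weakHopfType k) (A : ualgType k).
Variables (B : lmodType k).

(** The elements [h . theta(a)], whose span is [H . theta(A)]. *)
Definition act_image (mB : module_algebra H B) (theta : A -> B) (b : B) :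
    Prop := exists h a, b = mB h (theta a).

Record algebra_globalization (pA : partial_module_algebra H A)
    (mB : module_algebra H B) (theta : {linear A -> B}) : Prop :=
  AlgebraGlobalization {
  ag_inj : injective theta;
  ag_mul : forall a a', theta (a ** a') = ma_mul mB (theta a) (theta a');
  ag_ideal : forall a b, exists a', ma_mul mB (theta a) b = theta a';
  ag_act : forall h a, theta (pA h a) = ma_mul mB (theta \1) (mB h (theta a));
  ag_span : forall b, in_span (act_image mB theta) b
}.
End AlgebraGlobalization.

(** [mB] is the structure induced by [mE] on the subspace [B] spanned by [P];
    such an [mB] exists iff [B] is stable under the product and the action of
    [mE], and it is then unique. *)
Definition induced_module_algebra (k : fieldType) (H : weakHopfType k)
    (E : lmodType k) (P : E -> Prop) (mE : module_algebra H E)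
    (mB : module_algebra H (span P)) : Prop :=
  (forall x y, \val (ma_mul mB x y) = ma_mul mE (\val x) (\val y)) /\
  (forall h x, \val (mB h x) = mE h (\val x)).

Section Phi.
Variables (k : fieldType) (C D : coalgType k).
Variables (theta : coalgebra_mono C D) (pi : projection_onto theta).

(** The inverse of [theta] on its range, extended by [0]. *)
Definition theta_inv (d : D) : C := xget 0 [set c | theta c = d].

Lemma theta_invK c : theta_inv (theta c) = c.
Proof. by apply: xget_unique => // c'; apply: cm_inj. Qed.

Lemma theta_inv_pi d : theta (theta_inv (pi d)) = pi d.
Proof.
have : range theta (pi d) by rewrite -(pr_range pi); exists d.
by case=> c _ <-; rewrite theta_invK.
Qed.

Fact phi_scalar (f : dual C) : scalar (fun d => f (theta_inv (pi d))).
Proof.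
move=> a d d'; rewrite -linearP; congr (f _); apply: (@cm_inj _ _ _ theta).
by rewrite theta_inv_pi !linearP !theta_inv_pi.
Qed.

Definition phi (f : dual C) : dual D := mk_dual (phi_scalar f).

Fact phi_linear : linear phi.
Proof. by move=> a f g; apply: dualP. Qed.
HB.instance Definition _ :=
  GRing.isLinear.Build k (dual C) (dual D) *:%R phi phi_linear.

Variables (H : weakHopfType k) (mD : module_coalgebra H D).

Definition Hphi := span (act_image (dual_module_algebra mD) phi).

Fact phi_act_image f : act_image (dual_module_algebra mD) phi (phi f).
Proof. by exists \1, f; rewrite ma_act1. Qed.

Definition phi_corestr (f : dual C) : Hphi := mk_span (phi_act_image f).

Fact phi_corestr_linear : linear phi_corestr.
Proof. by move=> a f g; apply: val_inj; rewrite /= linearP. Qed.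
HB.instance Definition _ := GRing.isLinear.Build k (dual C) Hphi *:%R
  phi_corestr phi_corestr_linear.
End Phi.

(* Main.v *)
Require Import Defs.
From HB Require Import structures.
From mathcomp Require Import all_boot all_order all_algebra.
From mathcomp Require Import sesquilinear.
From mathcomp Require Import boolp classical_sets.

(** Put [p = theta^-1 \o pi], so that [phi f = f \o p]. Both sides of the
    equivalence amount to the identity
      [phi (h . f) = phi 1 ** (h |> phi f)]   for all [h] in [H], [f] in [C^*].
    Evaluated on [theta c], it says that [f] takes the same value at [c . h] and
    at [p (theta c . h)]; as functionals separate the points of [C], this is the
    compatibility of [pi] with the partial action. Evaluated on an arbitrary [d],
    it then gives the formula for [pi (pi d . h)].
    Conversely, the identity and the multiplicativity of [phi] give
    [phi f ** (h |> phi g) = phi (f ** (h . g))], whence the right ideal property;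
    the span of the [h |> phi f] is closed under products because
      [(h |> a) (l |> b) = h_1 |> (a (S(h_2) l |> b))],
    which holds over a weak Hopf algebra since
    [h_1 (x) h_2 S(h_3) = 1_1 h (x) 1_2]. *)

Set Implicit Arguments.
Unset Strict Implicit.
Unset Printing Implicit Defensive.

Import GRing.Theory.
Local Open Scope ring_scope.

Notation bilin f := (bilinear_for (GRing.Scale.Law.clone _ _ *:%R _)
                                  (GRing.Scale.Law.clone _ _ *:%R _) f).

(** * Sweedler sums under linear, bilinear and trilinear maps *)

Section Tensors.
Variable k : fieldType.

Lemma tliftP (U V W : lmodType k) (f g : U -> V -> W) (a : k) (t : U \otimes V) :
  \sw_(x, y <- t) (a *: f x y + g x y) = a *: tlift f t + tlift g t.
Proof. by rewrite /tlift big_split scaler_sumr. Qed.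

(** Variant of [raddf_tlift] for a map whose linearity is a hypothesis rather than a registered
    structure. *)
Lemma linear_tlift (U V W W' : lmodType k) (g : W -> W') (e : U -> V -> W)
    (t : U \otimes V) :
  linear g -> g (tlift e t) = \sw_(x, y <- t) g (e x y).
Proof.
move=> gP; exact: (raddf_tlift (HB.pack_for {linear W -> W'} g
  (GRing.isLinear.Build k _ _ _ g gP)) e t).
Qed.

Lemma tlift_tlift (U V U' V' W : lmodType k) (f : U -> V -> W)
    (e : U' -> V' -> U \otimes V) (t : U' \otimes V') :
  bilin f -> tlift f (tlift e t) = \sw_(x, y <- t) tlift f (e x y).
Proof. by move=> fP; apply: linear_tlift; apply: tlift_linear. Qed.

Definition trilin (U V X W : lmodType k) (T : U -> V -> X -> W) :=
  (forall z, bilin (fun x y => T x y z)) /\ (forall x y, linear (T x y)).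

Definition tlift3 (U V X W : lmodType k) (T : U -> V -> X -> W)
    (t : U \otimes V \otimes X) : W :=
  \sw_(u, z <- t) \sw_(x, y <- u) T x y z.

Section Trilinear.
Variables (U V X W : lmodType k) (T : U -> V -> X -> W).
Hypothesis TP : trilin T.

Lemma trilin_bilin : bilin (fun u z => \sw_(x, y <- u) T x y z).
Proof.
case: TP => T12 T3; split=> [z a u u'|u a z z'] /=.
  exact: tlift_linear (T12 z) a u u'.
by rewrite -tliftP; apply: eq_tlift => x y; rewrite T3.
Qed.

Lemma tlift3_linear : linear (tlift3 T).
Proof. exact/tlift_linear/trilin_bilin. Qed.

Lemma tlift3_tens u z : tlift3 T (u \ox z) = \sw_(x, y <- u) T x y z.
Proof. exact: tlift_tens trilin_bilin _ _. Qed.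

Lemma tlift3_tens2 x y z : tlift3 T (x \ox y \ox z) = T x y z.
Proof. by rewrite tlift3_tens tlift_tens //; case: TP. Qed.
End Trilinear.

(** The linear map that [T] induces on the threefold tensor product is applied to [comulA]. *)
Lemma comul_coassoc (C : coalgType k) (W : lmodType k) (T : C -> C -> C -> W) c :
  trilin T ->
  \sw_(x, y <- comul c) \sw_(a, b <- comul x) T a b y =
  \sw_(x, y <- comul c) \sw_(a, b <- comul y) T x a b.
Proof.
move=> TP; have TL := tlift3_linear TP.
have := congr1 (tlift3 T) (comulA c); rewrite !(linear_tlift _ _ TL) => e.
transitivity (\sw_(x, y <- comul c) tlift3 T (comul x \ox y)).
  by apply: eq_tlift => x y; rewrite tlift3_tens.
rewrite e; apply: eq_tlift => x y; rewrite (linear_tlift _ _ TL).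
by apply: eq_tlift => a b; rewrite tlift3_tens2.
Qed.

Lemma tmul_bilin (U V : lmodType k) (m : {bilinear U -> U -> U})
    (n : {bilinear V -> V -> V}) : bilin (tmul m n).
Proof.
have fP a b : bilin (fun c d => m a c \ox n b d).
  by split=> [v e u u'|u e v v'] /=; rewrite !(linearPr, linearPl).
split=> [t e s s'|s e t t'] /=; last first.
  rewrite /tmul -tliftP; apply: eq_tlift => a b.
  exact: (tlift_linear (fP a b)).
rewrite /tmul; apply: (@tlift_linear _ _ _ _
  (fun a b => \sw_(c, d <- t) (m a c \ox n b d))).
split=> [v a u u'|u a v v'] /=; rewrite -tliftP; apply: eq_tlift => x y.
  by rewrite !linearPl.
by rewrite linearPl linearPr.
Qed.

Lemma tmul_tens (U V : lmodType k) (m : {bilinear U -> U -> U})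
    (n : {bilinear V -> V -> V}) a b c d :
  tmul m n (a \ox b) (c \ox d) = m a c \ox n b d.
Proof.
rewrite /tmul tlift_tens ?tlift_tens //.
  by split=> [v e u u'|u e v v'] /=; rewrite !(linearPr, linearPl).
split=> [v e u u'|u e v v'] /=; rewrite -tliftP; apply: eq_tlift => x y.
  by rewrite !linearPl.
by rewrite linearPl linearPr.
Qed.

End Tensors.

(** * Antipode identities in a weak Hopf algebra *)

Section WeakHopf.
Variables (k : fieldType) (H : weakHopfType k).

(** [tmul3] is [tmul] with [tmul2] in its first factor; this instance makes the general facts on
    [tmul] apply to it. *)
HB.instance Definition _ := bilinear_isBilinear.Build k _ _ _ *:%R *:%R
  (@tmul2 k H) (tmul_bilin (@amul k H) (@amul k H)).

Lemma tlift_comulM (W : lmodType k) (F : H -> H -> W) (h l : H) : bilin F ->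
  tlift F (comul (h ** l)) =
  \sw_(a, b <- comul h) \sw_(c, d <- comul l) F (a ** c) (b ** d).
Proof.
move=> FP; rewrite comulM /tmul2 /tmul tlift_tlift //.
apply: eq_tlift => a b; rewrite tlift_tlift //.
by apply: eq_tlift => c d; rewrite tlift_tens.
Qed.

(** The map [p (x) q (x) r |-> p h_1 (x) eps(q h_2) r] is applied to [comul1_rl]. On [Delta^2(1)]
    the counit contracts [Delta(1_1 h)] to [1_1 h]; on the product, with terms [a (x) u b (x) v],
    the factor [a (x) b] is absorbed since [Delta(1) Delta(h) = Delta(h)]. *)
Lemma comul_eps_t (h : H) :
  \sw_(x, y <- comul h) (x \ox eps_t y) =
  \sw_(x, y <- comul \1) ((x ** h) \ox y).
Proof.
pose T (p q r : H) := \sw_(c, d <- comul h) ((p ** c) \ox (counit (q ** d) *: r)).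
have TP : trilin T.
  split=> [z|x y].
    split=> [y a x x'|x a y y'] /=; rewrite /T -tliftP; apply: eq_tlift => c d.
      by rewrite !linearPl.
    by rewrite linearPl /= linearP scalerDl -scalerA linearPr.
  move=> a z z'; rewrite /T -tliftP; apply: eq_tlift => c d.
  by rewrite scalerDr scalerA mulrC -scalerA linearPr.
have TL := tlift3_linear TP.
have lhsE : tlift3 T (tmul3 (one_comul1 H) (comul1_one H)) =
    \sw_(u, v <- comul \1) \sw_(a, b <- comul \1) T a (u ** b) v.
  rewrite /one_comul1 /tmul3.
  rewrite (@linear_tlift _ _ _ _ _ (fun s => tmul _ _ s _)); last first.
    by case: (tmul_bilin (@tmul2 k H) (@amul k H)) => + _; apply.
  rewrite (linear_tlift _ _ TL); apply: eq_tlift => u v.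
  rewrite tmul_tens tlift3_tens // amula1.
  rewrite [in LHS](tensorE (comul \1)).
  rewrite raddf_tlift.
  rewrite tlift_tlift; last by case: TP.
  apply: eq_tlift => a b.
  by rewrite /= /tmul2 tmul_tens tlift_tens ?amul1a //; case: TP.
have rhsE : tlift3 T (comul2_1 H) = \sw_(x, y <- comul \1) ((x ** h) \ox y).
  rewrite /comul2_1 (linear_tlift _ _ TL); apply: eq_tlift => x y.
  rewrite tlift3_tens // -[in RHS](counitr (x ** h)).
  rewrite tlift_comulM; last first.
    split=> [z a u u'|z a u u'] /=; first by rewrite scalerDr !scalerA mulrC.
    by rewrite linearP scalerDl scalerA.
  rewrite (@linear_tlift _ _ _ _ _ (fun z => z \ox y)); last exact: linearPl.
  apply: eq_tlift => p q.
  rewrite (@linear_tlift _ _ _ _ _ (fun z => z \ox y)); last exact: linearPl.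
  by apply: eq_tlift => c d; rewrite linearZl_LR linearZr_LR.
rewrite -rhsE -comul1_rl lhsE {lhsE rhsE}.
transitivity (\sw_(u, v <- comul \1) \sw_(x, y <- comul h)
                (x \ox (counit (u ** y) *: v))).
  rewrite exchange_tlift; apply: eq_tlift => x y.
  by rewrite /eps_t (linear_tlift (g := tens x)) //; exact: linearPr.
apply: eq_tlift => u v.
rewrite -[in LHS](amul1a h) tlift_comulM; last first.
  split=> [z a x x'|z a x x'] /=; first by rewrite linearPl.
  by rewrite linearPr linearP scalerDl -scalerA linearPr.
by apply: eq_tlift => a b; apply: eq_tlift => c d; rewrite amulA.
Qed.

(** Coassociativity regroups the left side so that [antipode_t] applies to its second leg. *)
Lemma comul_antipode (h : H) :
  \sw_(x, y <- comul h) \sw_(a, b <- comul x) (a \ox (b ** antipode y)) =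
  \sw_(x, y <- comul \1) ((x ** h) \ox y).
Proof.
rewrite -comul_eps_t (comul_coassoc (T := fun a b y => a \ox (b ** antipode y))).
  apply: eq_tlift => x y; rewrite -antipode_t (linear_tlift (g := tens x)) //.
  exact: linearPr.
split=> [z|x y].
  split=> [y a x x'|x a y y'] /=; first by rewrite linearPl.
  by rewrite linearPl linearPr.
by move=> a z z'; rewrite linearP !linearPr.
Qed.

Section ModuleAlgebra.
Variables (B : lmodType k) (mB : module_algebra H B).

(** Both sides equal [(1_1 h |> f) (1_2 l |> g)]: the left one after acting by [1] on the product,
    the right one by [comul_antipode]. *)
Lemma ma_mul_act (f g : B) (h l : H) :
  ma_mul mB (mB h f) (mB l g) =
  \sw_(x, y <- comul h) mB x (ma_mul mB f (mB (antipode y ** l) g)).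
Proof.
pose F (x y : H) := ma_mul mB (mB x f) (mB (y ** l) g).
have FP : bilin F.
  by split=> [y a x x'|x a y y'] /=; rewrite /F !(linearPl, linearPr).
transitivity (tlift F (\sw_(x, y <- comul \1) ((x ** h) \ox y))).
  rewrite tlift_tlift // -[LHS](ma_act1 mB) ma_actmul.
  by apply: eq_tlift => x y; rewrite tlift_tens // !ma_actM.
rewrite -comul_antipode tlift_tlift //; apply: eq_tlift => x y.
rewrite ma_actmul tlift_tlift //; apply: eq_tlift => a b.
by rewrite tlift_tens // /F ma_actM amulA.
Qed.

End ModuleAlgebra.
End WeakHopf.

(** * Induction on linear spans *)

Section Span.
Variables (k : fieldType) (V : lmodType k).

Lemma in_span_ind (P : V -> Prop) (Q : V -> Prop) :
  (forall v, P v -> Q v) -> Q 0 ->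
  (forall a u v, Q u -> Q v -> Q (a *: u + v)) -> forall v, in_span P v -> Q v.
Proof.
move=> PQ Q0 QD v [s sP ->]; elim: s sP => [|p s IHs] sP.
  by rewrite big_nil.
rewrite big_cons; apply: QD; first by apply/PQ/sP; rewrite inE eqxx.
by apply: IHs => q qs; apply: sP; rewrite inE qs orbT.
Qed.

Lemma in_spanP (P : V -> Prop) v : reflect (in_span P v) (v \in span_pred P).
Proof. exact: asboolP. Qed.

Lemma span_ind (P : V -> Prop) (Q : Defs.span P -> Prop) :
  (forall v (Pv : P v), Q (mk_span Pv)) -> Q 0 ->
  (forall a u v, Q u -> Q v -> Q (a *: u + v)) -> forall v, Q v.
Proof.
move=> PQ Q0 QD v.
(* [Q] concerns elements of the span, while [in_span_ind] runs over vectors of [V]; so [R] asks for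
   a lift, identified with [v] by injectivity of [val]. *)
pose R w := exists2 u : Defs.span P, \val u = w & Q u.
suff [u /val_inj<- //] : R (\val v).
apply: in_span_ind (span_valP v) => [w Pw||a w1 w2 [u1 <- Q1] [u2 <- Q2]].
- by exists (mk_span Pw).
- by exists 0.
- by exists (a *: u1 + u2); [rewrite linearP|exact: QD].
Qed.

End Span.

(** * The structure induced on a span stable under product and action *)

Section InducedModuleAlgebra.
Variables (k : fieldType) (H : weakHopfType k) (E : lmodType k) (P : E -> Prop).
Variable mE : module_algebra H E.
Hypothesis mulP : forall x y, P x -> P y -> in_span P (ma_mul mE x y).
Hypothesis actP : forall h x, P x -> in_span P (mE h x).

Lemma span_mul_closed x y :
  in_span P x -> in_span P y -> ma_mul mE x y \in span_pred P.
Proof.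
move=> xP; move: y; apply: in_span_ind; last 1 first.
- by move=> a u v uP vP; rewrite linearPr rpredD ?rpredZ.
- move=> y Py; move: x xP; apply: in_span_ind => [x Px||a u v uP vP].
  + exact/in_spanP/mulP.
  + by rewrite linear0l rpred0.
  + by rewrite linearPl rpredD ?rpredZ.
- by rewrite linear0r rpred0.
Qed.

Lemma span_act_closed h x : in_span P x -> mE h x \in span_pred P.
Proof.
move: x; apply: in_span_ind => [x Px||a u v uP vP].
- exact/in_spanP/actP.
- by rewrite linear0r rpred0.
- by rewrite linearPr rpredD ?rpredZ.
Qed.

Definition span_mul (x y : Defs.span P) : Defs.span P :=
  Span (span_mul_closed (span_valP x) (span_valP y)).
Definition span_act (h : H) (x : Defs.span P) : Defs.span P :=
  Span (span_act_closed h (span_valP x)).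

Lemma span_mul_bilin : bilin span_mul.
Proof.
by split=> [y a u v|x a u v] /=; apply: val_inj;
  rewrite /= ?linearP /= ?linearPl ?linearPr.
Qed.
Lemma span_act_bilin : bilin span_act.
Proof.
by split=> [y a u v|x a u v] /=; apply: val_inj;
  rewrite /= ?linearP /= ?linearPl ?linearPr.
Qed.
HB.instance Definition _ := bilinear_isBilinear.Build k _ _ _ *:%R *:%R
  span_mul span_mul_bilin.
HB.instance Definition _ := bilinear_isBilinear.Build k _ _ _ *:%R *:%R
  span_act span_act_bilin.

Lemma exists_induced_module_algebra :
  exists mB : module_algebra H (Defs.span P), induced_module_algebra mE mB.
Proof.
unshelve eexists (@ModuleAlgebra k H (Defs.span P) span_mul span_act _ _ _ _).
- by move=> x y z; apply: val_inj; rewrite /= ma_mulA.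
- by move=> x; apply: val_inj; rewrite /= ma_act1.
- move=> h x y; apply: val_inj; rewrite /= ma_actmul.
  by rewrite (linear_tlift (g := val)) //; exact: linearP.
- by move=> h l x; apply: val_inj; rewrite /= ma_actM.
by split.
Qed.

End InducedModuleAlgebra.

(** * Linear functionals separate points *)

Section DualSeparation.
Variables (k : fieldType) (V : lmodType k).

(* The functional is the coordinate along [v] with respect to a complement of
   the line spanned by [v]: a subspace maximal among those avoiding [v]. *)
Lemma exists_dual_neq0 (v : V) : v <> 0 -> exists f : dual V, f v <> 0.
Proof.
move=> v0.
pose P (X : set V) := (forall a x y, X x -> X y -> X (a *: x + y)) /\ ~ X v.
have [F FP Ftot|M [[Mlin Mv] Mmax]] := @Zorn_bigcup V P.
  split=> [a x y [X FX Xx] [Y FY Yy]|[X FX]]; last by have [_ +] := FP _ FX.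
  have [XY|YX] := Ftot _ _ FX FY.
    by exists Y => //; have [+ _] := FP _ FY; apply=> //; exact: XY.
  by exists X => //; have [+ _] := FP _ FX; apply=> //; exact: YX.
(* [P] admits the empty set, so maximality is needed here: without [0], [M] would be empty and
   strictly inside the set [0] alone. *)
have M0 : M 0.
  apply: contrapT => M0; apply: (Mmax [set 0]%classic).
    split=> [x Mx|sub]; last by apply/M0/sub.
    by case: M0; have := Mlin (-1) _ _ Mx Mx; rewrite scaleN1r addNr.
  split=> [a x y -> ->|/= v0']; last exact/v0/v0'.
  by rewrite /= scaler0 addr0.
have MD x y : M x -> M y -> M (x + y).
  by move=> Mx My; rewrite -[x]scale1r; exact: Mlin.
have MZ a x : M x -> M (a *: x).
  by move=> Mx; rewrite -[a *: x]addr0; exact: Mlin.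
have MN x : M x -> M (- x) by move=> Mx; rewrite -scaleN1r; exact: MZ.
have ex x : exists a, M (x - a *: v).
  have [Mx|Mx] := pselect (M x); first by exists 0; rewrite scale0r subr0.
  (* [N] is the sum of [M] and the line through [x]. It is strictly larger than [M], hence contains
     [v], and a relation [v + a x] in [M] with [a] nonzero is solved for [x]. *)
  pose N : set V := [set z | exists a, M (z + a *: x)]%classic.
  have Nv : N v.
    apply: contrapT => Nv; apply: (Mmax N).
      split=> [z Mz|sub]; first by exists 0; rewrite scale0r addr0.
      by apply/Mx/sub; exists (-1); rewrite scaleN1r subrr.
    split=> // a y z [b yP] [c zP]; exists (a * b + c).
    rewrite scalerDl -scalerA addrACA -scalerDr; exact: Mlin.
  have [a av] := Nv.
  have a0 : a != 0.
    by apply/eqP => a0; apply: Mv; move: av; rewrite a0 scale0r addr0.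
  exists (- a^-1); have := MZ a^-1 _ av.
  by rewrite scalerDr scalerA mulVf // scale1r scaleNr opprK addrC.
have uniq x a b : M (x - a *: v) -> M (x - b *: v) -> a = b.
  move=> xa xb; apply: contrapT => /eqP ab; apply: Mv.
  have := MD _ _ xb (MN _ xa).
  rewrite opprB addrC subrKA -scalerBl => /(MZ (a - b)^-1).
  by rewrite scalerA mulVf ?scale1r // subr_eq0.
(* The default [0] is never reached, by [ex]; linearity comes from [uniq]. *)
pose f x := xget 0 [set a | M (x - a *: v)]%classic.
have fM x : M (x - f x *: v).
  by rewrite /f; case: xgetP => // nP; have [a /nP] := ex x.
have fP : scalar f.
  move=> a x y; apply: (uniq (a *: x + y)); first exact: fM.
  rewrite scalerDl -scalerA opprD addrACA -scalerBr; exact: Mlin.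
exists (mk_dual fP) => /= fv0; apply: Mv.
by have := fM v; rewrite fv0 scale0r subr0.
Qed.

Lemma dual_separates (v w : V) : (forall f : dual V, f v = f w) -> v = w.
Proof.
move=> vw; apply/eqP; rewrite -subr_eq0; apply/eqP.
by apply: contrapT => /exists_dual_neq0[f]; rewrite linearB vw subrr.
Qed.

End DualSeparation.

(** * Transfer between [C] and its dual through [phi] *)

Section Globalization.
Variables (k : fieldType) (H : weakHopfType k) (C D : coalgType k).
Variables (pC : partial_module_coalgebra H C) (mD : module_coalgebra H D).
Variables (theta : coalgebra_mono C D) (pi : projection_onto theta).

Lemma pi_theta c : pi (theta c) = theta c.
Proof.
have : range theta (theta c) by exists c.
by rewrite -(pr_range pi) => -[d _ <-]; rewrite pr_idem.
Qed.

Lemma phi_theta (f : dual C) c : phi pi f (theta c) = f c.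
Proof. by rewrite /= pi_theta theta_invK. Qed.

Lemma phi_pi (f : dual C) d : phi pi f (pi d) = phi pi f d.
Proof. by rewrite /= pr_idem. Qed.

Lemma phi_inj : injective (phi pi).
Proof. by move=> f g fg; apply: dualP => c; rewrite -!phi_theta fg. Qed.

Lemma counit_pi d : counit (pi d) = phi pi \1 d.
Proof. by rewrite -theta_inv_pi cm_counit. Qed.

Lemma conv_theta (f g : dual D) c :
  (f ** g) (theta c) = \sw_(x, y <- comul c) (f (theta x) * g (theta y)).
Proof.
rewrite dualM cm_comul /tmap (scalar_tlift _ _ (conv_scalar2 f g)).
by apply: eq_tlift => x y; rewrite conv_tens.
Qed.

(** On the range of [theta], [phi 1] agrees with the counit, the unit of the convolution product. *)
Lemma phi1_conv_theta (g : dual D) c : (phi pi \1 ** g) (theta c) = g (theta c).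
Proof.
rewrite -[in RHS](amul1a g) !conv_theta; apply: eq_tlift => x y.
by rewrite phi_theta !dual1 cm_counit.
Qed.

Hypothesis pi_comul : proj_comul mD pi.

Lemma comul_pi d : comul (pi d) = tmap pi pi (comul d).
Proof. by have := pi_comul d \1; rewrite mc_act1. Qed.

(** Both sides are unchanged when [d] is replaced by [pi d], the product because of [comul_pi]; on
    the range of [theta] each [phi f] restricts to [f]. *)
Lemma phiM (f g : dual C) : phi pi (f ** g) = phi pi f ** phi pi g.
Proof.
apply: dualP => d.
transitivity ((phi pi f ** phi pi g) (pi d)).
  rewrite -[in RHS]theta_inv_pi conv_theta.
  by apply: eq_tlift => x y; rewrite !phi_theta.
rewrite dualM comul_pi /tmap (scalar_tlift _ _ (conv_scalar2 _ _)).
by apply: eq_tlift => x y; rewrite conv_tens !phi_pi.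
Qed.

Definition phi_equivariant :=
  forall h f, phi pi (dual_act pC h f) = phi pi \1 ** dual_act mD h (phi pi f).

(** At [d], [cg_pact] turns the left side into [phi f (pi (pi d . h))], which [cg_act] expands; the
    coefficient [counit (pi d1)] is [phi 1] at [d1]. *)
Lemma globalization_equivariant :
  coalgebra_globalization pC mD pi -> phi_equivariant.
Proof.
case=> _ pi_act pact _ h f; apply: dualP => d.
rewrite -[LHS]/(f (pC (theta_inv theta (pi d)) h)) -[LHS]phi_theta.
rewrite pact theta_inv_pi pi_act (scalar_tlift _ _ (scalarP (phi pi f))).
apply: eq_tlift => x y.
by rewrite (scalarZ (phi pi f)) phi_pi counit_pi.
Qed.

Lemma equivariant_pact : phi_equivariant ->
  forall c h, theta (pC c h) = pi (mD (theta c) h).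
Proof.
move=> phiE c h; rewrite -theta_inv_pi; congr (theta _).
apply: dual_separates => f.
rewrite -[RHS]/(dual_act mD h (phi pi f) (theta c)) -phi1_conv_theta -phiE.
by rewrite phi_theta.
Qed.

Lemma equivariant_act : phi_equivariant ->
  forall d h, pi (mD (pi d) h) =
    \sw_(d1, d2 <- comul d) (counit (pi d1) *: pi (mD d2 h)).
Proof.
move=> phiE d h; rewrite -[X in mD X h]theta_inv_pi -equivariant_pact //.
set r := (RHS).
(* The right side is fixed by [pi], so both sides lie in the range of [theta] and their preimages
   can be compared by functionals. *)
have -> : r = pi r.
  rewrite /r (linear_tlift (g := pi)); last exact: linearP.
  by apply: eq_tlift => x y; rewrite linearZ /= pr_idem.
rewrite -[RHS]theta_inv_pi; congr (theta _); apply: dual_separates => f.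
transitivity (phi pi (dual_act pC h f) d); first by [].
transitivity (phi pi f r); last by [].
rewrite phiE /r (scalar_tlift _ _ (scalarP (phi pi f))).
apply: eq_tlift => x y.
by rewrite (scalarZ (phi pi f)) phi_pi counit_pi.
Qed.

Let P := act_image (dual_module_algebra mD) (phi pi).

(** The factor [phi 1] brought in by equivariance is absorbed by [phi f], since [phi] is
    multiplicative. *)
Lemma phi_mul_act : phi_equivariant -> forall f g h,
  phi pi f ** dual_act mD h (phi pi g) = phi pi (f ** dual_act pC h g).
Proof. by move=> phiE f g h; rewrite phiM phiE amulA -phiM amula1. Qed.

Lemma act_image_mul : phi_equivariant -> forall x y, P x -> P y ->
  in_span P (ma_mul (dual_module_algebra mD) x y).
Proof.
move=> phiE x y [h [f ->]] [l [g ->]]; apply/in_spanP; rewrite ma_mul_act; apply: rpred_sum => p _.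
(* Each summand is [x |> phi (f ** (S(y) l . g))], by [phi_mul_act], hence a generator. *)
apply/in_spanP/in_span_gen.
rewrite /= phi_mul_act //; by do 2![eexists].
Qed.

Lemma act_image_act h x : P x -> in_span P (dual_module_algebra mD h x).
Proof.
move=> [l [f ->]]; apply: in_span_gen; exists (h ** l), f.
by rewrite ma_actM.
Qed.

Lemma equivariant_algebra_globalization (mB : module_algebra H (Hphi pi mD)) :
  phi_equivariant -> induced_module_algebra (dual_module_algebra mD) mB ->
  algebra_globalization (dual_partial_module_algebra pC) mB (phi_corestr pi mD).
Proof.
move=> phiE [mulE actE]; split.
- by move=> f g /(congr1 val) /phi_inj.
- by move=> f g; apply: val_inj; rewrite mulE /= phiM.
(* Right ideal: [phi_mul_act] supplies the witness on a generator, and witnesses combine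
   linearly. *)
- move=> f; apply: span_ind => [v [h [g vE]]||a u v [f1 E1] [f2 E2]].
  + exists (f ** dual_act pC h g); apply: val_inj.
    by rewrite mulE /= vE -phi_mul_act.
  + by exists 0; rewrite !linear0r linear0.
  + by exists (a *: f1 + f2); rewrite linearPr E1 E2 linearP.
- by move=> h f; apply: val_inj; rewrite mulE actE /= phiE.
- move=> b; apply/in_spanP; move: b; apply: span_ind => [v Pv||a u v uP vP].
  + have [h [f vE]] := Pv; apply/in_spanP/in_span_gen; exists h, f.
    by apply: val_inj; rewrite actE /= vE.
  + exact: rpred0.
  + by apply: rpredD => //; apply: rpredZ.
Qed.

End Globalization.

Theorem mainTheorem4 (k : fieldType) (H : weakHopfType k) (C D : coalgType k)
    (pC : partial_module_coalgebra H C) (mD : module_coalgebra H D)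
    (theta : coalgebra_mono C D) (pi : projection_onto theta)
    (D_span : forall d, in_span (image_act mD theta) d)
    (pi_comul : proj_comul mD pi) :
  coalgebra_globalization pC mD pi
  <->
  exists2 mB : module_algebra H (Hphi pi mD),
    induced_module_algebra (dual_module_algebra mD) mB &
    algebra_globalization (dual_partial_module_algebra pC) mB
      (phi_corestr pi mD).
Proof.
split=> [/globalization_equivariant phiE|[mB [mulE actE] gB]].
  have [mB mBP] := exists_induced_module_algebra
    (act_image_mul pi_comul phiE) (act_image_act (pi := pi) (mD := mD)).
  by exists mB => //; exact: equivariant_algebra_globalization.
have phiE : phi_equivariant pC mD pi.
  (* [ag_act] is an identity in the span; read in [D^*] through [val], it is equivariance. *)
  move=> h f; have /(congr1 val) := ag_act gB h f.
  by rewrite mulE actE.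
split=> //; first exact: equivariant_act.
exact: equivariant_pact.
Qed.
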